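(* Fix $t>0$, let $\mathcal{M}$ be a compact connected Riemannian manifold and let $X$ be a random variable on $\mathcal{M}$. Then the diffusion estimator $E_{t,n}$ is strongly consistent in the sense of Ziezold and in the sense of Bhattacharya and Patrangenaru; that is, for almost all $\omega$ $$\bigcap_{n=1}^\infty\overline{\bigcup_{k=n}^\infty E_{t,k}(\omega)}\subset E_t(X),$$ and $E_t(X)\neq\emptyset$ and for every $\varepsilon>0$ and almost all $\omega$ there is a number $n=n(\varepsilon,\omega)>0$ such that $$\bigcup_{k=n}^\infty E_{t,k}(\omega)\subset B(E_t(X),\varepsilon).$$
   Context: $p(x,y,t)$ is the heat kernel of $\mathcal{M}$: the minimal solution of $\frac{d}{dt}u(x,y,t)=\frac12\Delta_x u(x,y,t)$ with $\int_{\mathcal{M}}p(x,y,t)\,dy=1$ for all $x\in\mathcal{M}$, $t>0$. The diffusion $t$-mean set is $E_t(X)=\operatorname{argmin}_{y\in\mathcal{M}}\mathbb{E}[-\ln p(X,y,t)]$. For i.i.d. samples $X_1,X_2,\dots\sim X$, the diffusion estimator is the collection of random closed sets $E_{t,n}=\operatorname{argmin}_{y\in\mathcal{M}}\big(-\frac1n\sum_{i=1}^n\ln p(X_i,y,t)\big)$. $B(E,\varepsilon)$ is the union of balls of radius $\varepsilon$ around all points of $E$. *)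

(* Defs.v *)
From HB Require Import structures.
From mathcomp Require Import all_boot all_order all_algebra.
From mathcomp Require Import all_classical all_reals all_analysis.

Set Implicit Arguments.
Unset Strict Implicit.
Unset Printing Implicit Defensive.

Import Order.TTheory GRing.Theory Num.Theory.
Import numFieldNormedType.Exports.

Local Open Scope classical_set_scope.
Local Open Scope ring_scope.

Section Calculus.
Variables (R : realType) (n : nat).
Implicit Types (U : set 'rV[R]_n) (f : 'rV[R]_n -> R).

Definition partial (a : 'I_n) f : 'rV[R]_n -> R :=
  fun v => 'D_(delta_mx 0 a) f v.

(* Only meant for open [U]: every iterated partial derivative of order [< k]
   can be differentiated again, and those of order [<= k] are continuous. *)
Definition Ck_on (k : nat) U f : Prop :=
  forall s : seq 'I_n, (size s <= k)%N -> forall v, U v ->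
    {for v, continuous (foldr partial f s)} /\
    ((size s < k)%N ->
       forall a, derivable (foldr partial f s) v (delta_mx 0 a)).

Definition smooth_on U f : Prop := forall k, Ck_on k U f.

End Calculus.

(* Iterated integral over the coordinates; by Tonelli it is the integral against
   n-dimensional Lebesgue measure for nonnegative Borel functions, the only
   ones it is used for. *)
Fixpoint integral_rV (R : realType) (n : nat) :
    ('rV[R]_n -> \bar R) -> \bar R :=
  match n with
  | 0%N => fun f => f 0
  | m.+1 => fun f => (\int[lebesgue_measure]_x
      integral_rV (fun v : 'rV[R]_m => f (row_mx (x%:M : 'rV[R]_1) v)))%E
  end.

Definition borel (M : ptopologicalType) := g_sigma_algebraType (@open M).

(* A Riemannian manifold without boundary, of dimension [n].  The tensor is
   given by its matrix in each chart; [chart_param i] is only relevant as the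
   inverse of the chart [chart_coord i : dom i -> 'rV_n].  [chart_at] picks a chart
   around each point. *)
Record riemannian_manifold (R : realType) (n : nat) (M : ptopologicalType) := {
  chart : Type ;
  dom : chart -> set M ;
  chart_coord : chart -> M -> 'rV[R]_n ;
  chart_param : chart -> 'rV[R]_n -> M ;
  chart_at : M -> chart ;
  metric : chart -> M -> 'M[R]_n ;
  manifold_hausdorff : hausdorff_space M ;
  manifold_second_countable : @second_countable M ;
  dom_chart_at : forall x, dom (chart_at x) x ;
  open_dom : forall i, open (dom i) ;
  open_codom : forall i, open (chart_coord i @` dom i) ;
  chart_coordK : forall i x, dom i x -> chart_param i (chart_coord i x) = x ;
  coord_continuous : forall i x, dom i x -> {for x, continuous (chart_coord i)} ;
  param_continuous : forall i v, (chart_coord i @` dom i) v ->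
    {for v, continuous (chart_param i)} ;
  transition_smooth : forall i j (b : 'I_n),
    smooth_on (chart_coord i @` (dom i `&` dom j))
              (fun v => chart_coord j (chart_param i v) 0 b) ;
  metric_sym : forall i x, dom i x -> (metric i x)^T = metric i x ;
  metric_posdef : forall i x, dom i x -> forall v : 'rV[R]_n, v != 0 ->
    0 < (v *m metric i x *m v^T) 0 0 ;
  metric_smooth : forall i (a b : 'I_n),
    smooth_on (chart_coord i @` dom i) (fun v => metric i (chart_param i v) a b) ;
  metric_transition : forall i j x, dom i x -> dom j x ->
    let J := \matrix_(a < n, b < n)
      partial a (fun v => chart_coord j (chart_param i v) 0 b) (chart_coord i x) in
    metric i x = J *m metric j x *m J^T
}.

Section RiemannianGeometry.
Variables (R : realType) (n : nat) (M : ptopologicalType).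
Variable g : riemannian_manifold R n M.

Definition Ck_manifold (k : nat) (f : M -> R) : Prop :=
  forall i : chart g, Ck_on k (chart_coord i @` dom i) (f \o chart_param i).

Definition chart_length (i : chart g) (c : R -> 'rV[R]_n) : \bar R :=
  (\int[lebesgue_measure]_(s in `[(0 : R)%R, 1%R])
    (Num.sqrt ((derive1 c s *m metric i (chart_param i (c s)) *m (derive1 c s)^T) 0 0))%:E)%E.

(* [curve_length x y l]: some piecewise C^1 curve from [x] to [y] has length
   [l].  The curve is cut into finitely many C^1 pieces, each of them lying in
   a single chart; a piece is the restriction to [0, 1] of a C^1 map on R. *)
Inductive curve_length : M -> M -> \bar R -> Prop :=
| curve_nil x : curve_length x x 0%E
| curve_cons (i : chart g) (c : R -> 'rV[R]_n) y l :
    (forall s, derivable c s 1) -> continuous (derive1 c) ->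
    (forall s, 0 <= s <= 1 -> (chart_coord i @` dom i) (c s)) ->
    curve_length (chart_param i (c 1)) y l ->
    curve_length (chart_param i (c 0)) y (chart_length i c + l)%E.

Definition riemannian_dist (x y : M) : \bar R :=
  ereal_inf [set l | curve_length x y l].

Definition nbhd_of_set (E : set M) (e : R) : set M :=
  \bigcup_(x in E) [set y | (riemannian_dist x y < e%:E)%E].

Definition is_riemannian_volume (vol : {measure set (borel M) -> \bar R}) :
    Prop :=
  forall (i : chart g) (A : set (borel M)), measurable A -> A `<=` dom i ->
    vol A = integral_rV (fun v =>
      (\1_(chart_coord i @` A) v * Num.sqrt (\det (metric i (chart_param i v))))%:E).

(* det(g)^(-1/2) sum_a d_a (det(g)^(1/2) sum_b g^(ab) d_b f) *)
Definition laplacian (f : M -> R) (x : M) : R :=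
  let i := chart_at g x in
  let G v := metric i (chart_param i v) in
  let sqrtdet v := Num.sqrt (\det (G v)) in
  (sqrtdet (chart_coord i x))^-1 *
  \sum_(a < n) partial a (fun v => sqrtdet v *
    \sum_(b < n) invmx (G v) a b * partial b (f \o chart_param i) v) (chart_coord i x).

Variable vol : {measure set (borel M) -> \bar R}.

Record fundamental_solution (p : M -> M -> R -> R) : Prop := {
  fundamental_continuous : forall x y (t : R), 0 < t ->
    {for (x, y, t), continuous (fun z : M * M * R => p z.1.1 z.1.2 z.2)} ;
  fundamental_C2 : forall y (t : R), 0 < t -> Ck_manifold 2 (fun x => p x y t) ;
  fundamental_C1 : forall x y (t : R), 0 < t ->
    derivable (p x y) t 1 /\ {for t, continuous (derive1 (p x y))} ;
  fundamental_heat : forall x y (t : R), 0 < t ->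
    derive1 (p x y) t = 2^-1 * laplacian (fun z => p z y t) x ;
  (* p(., y, t) converges weakly to the Dirac mass at y as t goes to 0+ *)
  fundamental_dirac : forall y (f : M -> R), continuous f ->
    (exists c : R, forall x, `|f x| <= c) ->
    (\int[vol]_x (p x y t * f x)%:E)%E @[t --> 0^'+] --> (f y)%:E
}.

Record heat_kernel (p : M -> M -> R -> R) : Prop := {
  heat_kernel_fundamental : fundamental_solution p ;
  heat_kernel_ge0 : forall x y (t : R), 0 < t -> 0 <= p x y t ;
  heat_kernel_minimal : forall q, fundamental_solution q ->
    (forall x y (t : R), 0 < t -> 0 <= q x y t) ->
    forall x y (t : R), 0 < t -> p x y t <= q x y t ;
  heat_kernel_mass1 : forall x (t : R), 0 < t -> (\int[vol]_y (p x y t)%:E = 1)%E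
}.

End RiemannianGeometry.

Section Probability.
Variables (R : realType) (d d' : measure_display) (T : measurableType d).
Variables (S : measurableType d') (P : probability T R).

Definition mutually_independent (X : nat -> {RV P >-> S}) : Prop :=
  forall (s : seq nat) (A : nat -> set S), uniq s ->
    (forall i, measurable (A i)) ->
    P (\bigcap_(i in [set` s]) (X i @^-1` A i)) =
    (\prod_(i <- s) P (X i @^-1` A i))%E.

Definition same_law (X Y : {RV P >-> S}) : Prop :=
  forall A : set S, measurable A ->
    distribution P X A = distribution P Y A.

Definition iid_samples (X : {RV P >-> S}) (Xs : nat -> {RV P >-> S}) : Prop :=
  mutually_independent Xs /\ forall i, same_law (Xs i) X.

End Probability.

Definition argmin (R : realType) (M : Type) (F : M -> \bar R) : set M :=
  [set y | forall z, (F y <= F z)%E].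

Section DiffusionMeans.
Variables (R : realType) (M : ptopologicalType) (p : M -> M -> R -> R).
Variables (d : measure_display) (T : measurableType d) (P : probability T R).

(* Extended logarithm: a zero of p contributes - ln 0 = +oo. *)
Definition neg_log_density (t : R) (x y : M) : \bar R :=
  (- lne (p x y t)%:E)%E.

(* The expectation is an extended-real integral, hence may be +oo. *)
Definition diffusion_mean_set (X : {RV P >-> borel M}) (t : R) : set M :=
  argmin (fun y => \int[P]_w neg_log_density t (X w) y)%E.

(* The sample X_1, X_2, ... is indexed from 0, so the first [k] observations
   are [Xs 0, ..., Xs k.-1]; only [0 < k] is meaningful. *)
Definition diffusion_estimator (Xs : nat -> {RV P >-> borel M}) (t : R)
    (k : nat) (w : T) : set M :=
  argmin (fun y =>
    (k%:R^-1)%:E * \sum_(i < k) neg_log_density t (Xs i w) y)%E.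

End DiffusionMeans.

(* Main.v *)
(** With C >= sup p(.,.,t), the loss h(x,y) = - ln (p(x,y,t) / C) takes values in
    [0,+oo], and is the increasing limit of the continuous truncations
    phi_k = min(h, k).  Strict positivity of the heat kernel is therefore not
    needed, provided the law of large numbers is used one-sidedly:
    at a minimiser y0 of finite mean loss, limsup of the empirical mean of
    h(.,y0) is at most its expectation (integrable, maybe unbounded, variables);
    for each k the empirical means of phi_k(.,y) are eventually bounded below by
    their expectations, uniformly in y by equicontinuity and finite nets.
    Comparing both along a cluster point of empirical minimisers and letting
    k -> oo by monotone convergence gives consistency in the sense of Ziezold;
    compactness then gives the Bhattacharya-Patrangenaru version, since small
    Riemannian balls are neighbourhoods of their centres.

    The one-sided law of large numbers for Z_i >= 0 uses only pairwise
    independence: along the sample sizes c * 2 ^ j, truncate Z at 2 ^ j, apply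
    Chebyshev, and sum over j by the pointwise bound
    sum_j 2 ^ -j * min(Z, 2 ^ j) ^ 2 <= 4 Z. *)

Require Import Defs.
From HB Require Import structures.
From mathcomp Require Import all_boot all_order all_algebra.
From mathcomp Require Import finmap.
From mathcomp Require Import all_classical all_reals all_analysis.
From mathcomp Require Import measurable_realfun.
From mathcomp Require Import ring lra.
Import Order.TTheory GRing.Theory Num.Theory.
Import numFieldNormedType.Exports.
Local Open Scope classical_set_scope.
Local Open Scope ring_scope.
Set Implicit Arguments.
Unset Strict Implicit.
Unset Printing Implicit Defensive.

(** * Dyadic truncation and interpolation *)

Lemma dyadic_truncation_sum {R : realType} (z : R) (n : nat) : 0 <= z ->
  \sum_(j < n) 2 ^- j * Order.min z (2 ^+ j) ^+ 2 <= 4 * z.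
Proof.
move=> z0.
(* Stronger form for the induction. While [2 ^+ n < z] the terms are [2 ^+ j] and sum to less than
   [2 ^+ n]; later terms are [2 ^- j * z ^+ 2], and the subtracted [2 * 2 ^- n * z ^+ 2] is the
   geometric tail still to come. *)
suff : \sum_(j < n) 2 ^- j * Order.min z (2 ^+ j) ^+ 2 <=
    if z <= 2 ^+ n then 4 * z - 2 * 2 ^- n * z ^+ 2 else 2 ^+ n.
  case: ifPn => [zn|]; last by rewrite -ltNge; lra.
  move/le_trans; apply.
  have : 0 <= (2 : R) ^- n * z ^+ 2 by rewrite mulr_ge0// ?invr_ge0 ?exprn_ge0.
  by lra.
elim: n => [|n IHn].
  by rewrite big_ord0 expr0 invr1; case: ifPn => // z1; nra.
rewrite big_ord_recr/=.
have a0 : 0 < (2 : R) ^+ n by rewrite exprn_gt0.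
rewrite !(exprS 2 n) invfM; set a := 2 ^+ n in IHn a0 *.
have aa : a^-1 * a = 1 by rewrite mulVf ?gt_eqF.
have ia0 : 0 < a^-1 by rewrite invr_gt0.
move: IHn; have [za|za] := leP z a.
  by move=> IHn; rewrite ifT; lra.
move=> IHn.
have -> : a^-1 * a ^+ 2 = a by rewrite expr2 mulrA aa mul1r.
case: ifPn => z2a; last by lra.
(* The step at which the cap passes [z]: rescaled by [2 ^+ n], it asks for [2 <= 4 * s - s ^+ 2] on
   [1 < s <= 2]. *)
pose s := a^-1 * z.
have zE : z = a * s by rewrite /s mulrA mulfV ?mul1r ?gt_eqF.
have s1 : 1 < s by move: za; rewrite zE ltr_pMr.
have s2 : s <= 2 by move: z2a; rewrite zE mulrC ler_pM2r.
have -> : 4 * z - 2 * (2^-1 * a^-1) * z ^+ 2 = a * (4 * s - s ^+ 2).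
  by rewrite zE; field; rewrite gt_eqF.
apply: (@le_trans _ _ (a * 2)); first lra.
by rewrite ler_pM2l//; nra.
Qed.

Lemma le_sum_index {R : numDomainType} (z : nat -> R) (m k : nat) :
  (forall i, 0 <= z i) -> (m <= k)%N ->
  \sum_(i < m) z i <= \sum_(i < k) z i.
Proof.
move=> z0 mk; rewrite -!(big_mkord xpredT z).
rewrite (@big_cat_nat _ _ _ _ _ _ _ _ (leq0n m) mk)//=.
by rewrite lerDl sumr_ge0.
Qed.

(* Every large m satisfies c * 2 ^ j <= m < c.+1 * 2 ^ j for some j and some c
   in [q, 2 * q), so that the two bounds differ by a factor at most 1 + 1 / q. *)
Lemma sum_dyadic_interpolation {R : realType} (z : nat -> R) (mu e : R) :
  (forall i, 0 <= z i) -> 0 <= mu -> 0 < e ->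
  (forall c l : nat, (0 < c)%N ->
    \forall j \near \oo, \sum_(i < c * 2 ^ j) z i
      <= (c * 2 ^ j)%:R * (mu + l.+1%:R^-1)) ->
  \forall m \near \oo, \sum_(i < m) z i <= m%:R * (mu + e).
Proof.
move=> z0 mu0 e0 H.
pose l := Num.truncn (2 / e).
have lP : l.+1%:R^-1 < e / 2.
  have l1 : 2 / e < l.+1%:R by rewrite /l truncnS_gt// divr_ge0// ltW.
  by rewrite -[e / 2]invrK invf_div ltf_pV2// posrE// ?divr_gt0.
(* This size gives [(c + 1) * (mu + e / 2) <= c * (mu + e)] for every [c >= q]. *)
pose q := (Num.truncn (2 * (mu + e) / e)).+1.
have qP : 2 * (mu + e) / e < q%:R by rewrite /q truncnS_gt.
have q0 : (0 : R) < q%:R by rewrite ltr0n.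
have qe : 2 * (mu + e) < q%:R * e by rewrite -ltr_pdivrMr.
(* Only finitely many [c] are involved, so one threshold [J] serves them all. *)
have [J JP] : exists J, forall c, (q <= c < 2 * q)%N -> forall j, (J <= j)%N ->
   \sum_(i < c.+1 * 2 ^ j) z i <= (c.+1 * 2 ^ j)%:R * (mu + l.+1%:R^-1).
  have : \forall j \near \oo, forall c : 'I_(2 * q),
     \sum_(i < c.+1 * 2 ^ j) z i <= (c.+1 * 2 ^ j)%:R * (mu + l.+1%:R^-1).
    by apply: filter_forall => c; exact: H.
  case=> J _ JP; exists J => c /andP[_ c2q] j Jj.
  exact: (JP j Jj (Ordinal c2q)).
exists (q * 2 ^ J)%N => // m /= Jm.
have qgt0 : (0 < q)%N by [].
have mq0 : (0 < m %/ q)%N.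
  by rewrite divn_gt0// (leq_trans _ Jm)// leq_pmulr// expn_gt0.
(* The largest [j] with [q * 2 ^ j <= m]; by maximality [m %/ 2 ^ j] stays below [2 * q]. *)
pose j := trunc_log 2 (m %/ q).
have /andP[j1 j2] := trunc_log_bounds (isT : (1 < 2)%N) mq0.
rewrite -/j in j1 j2.
have Jj : (J <= j)%N.
  by apply: trunc_log_max => //; rewrite leq_divRL// mulnC.
pose c := (m %/ 2 ^ j)%N.
have p0 : (0 < 2 ^ j)%N by rewrite expn_gt0.
have qc : (q <= c)%N by rewrite leq_divRL// mulnC -leq_divRL.
have c2q : (c < 2 * q)%N.
  by rewrite ltn_divLR// mulnAC -expnS -ltn_divLR.
have mc : (m < c.+1 * 2 ^ j)%N by rewrite -ltn_divLR.
have cm : (c * 2 ^ j <= m)%N by rewrite leq_trunc_div.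
have := le_trans (le_sum_index z0 (ltnW mc)) (JP c _ j Jj).
rewrite qc c2q => /(_ isT)/le_trans; apply.
have : (c.+1 * 2 ^ j)%:R * (mu + l.+1%:R^-1) <=
   (c.+1 * 2 ^ j)%:R * (mu + e / 2) :> R.
  by rewrite ler_wpM2l// lerD2l ltW.
move/le_trans; apply.
apply: (@le_trans _ _ ((c * 2 ^ j)%:R * (mu + e))); last first.
  by rewrite ler_wpM2r ?ler_nat// addr_ge0// ltW.
have -> : (c.+1 * 2 ^ j)%:R * (mu + e / 2) =
    (2 ^ j)%:R * ((c%:R + 1) * (mu + e / 2)) :> R by rewrite natrM -natr1; ring.
have -> : (c * 2 ^ j)%:R * (mu + e) = (2 ^ j)%:R * (c%:R * (mu + e)) :> R.
  by rewrite natrM; ring.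
rewrite ler_pM2l ?ltr0n//.
have : q%:R * e <= c%:R * e by rewrite ler_pM2r ?ler_nat.
lra.
Qed.

(** * One-sided law of large numbers *)

Section IidIntegrals.
Context (R : realType) (d d' : measure_display) (T : measurableType d).
Context (S : measurableType d') (P : probability T R).
Context (X : {RV P >-> S}) (Xs : nat -> {RV P >-> S}).
Hypothesis Xs_iid : iid_samples X Xs.

Lemma integral_iid (i : nat) (u : S -> \bar R) :
  measurable_fun setT u -> (forall x, 0 <= u x)%E ->
  (\int[P]_w u (Xs i w) = \int[P]_w u (X w))%E.
Proof.
move=> mu u0; rewrite -(ge0_integral_distribution (Xs i) mu u0).
rewrite -(ge0_integral_distribution X mu u0).
by apply: eq_measure_integral => A mA _; exact: (Xs_iid.2 i A mA).
Qed.

(** Independence identifies the joint law of [Xs i] and [Xs k] with the product law on rectangles,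
    hence everywhere, and Tonelli splits the integral. *)
Lemma integral_iid_mul (i k : nat) (u : S -> \bar R) : i != k ->
  measurable_fun setT u -> (forall x, 0 <= u x)%E ->
  (\int[P]_w (u (Xs i w) * u (Xs k w)) =
   (\int[P]_w u (X w)) * (\int[P]_w u (X w)))%E.
Proof.
move=> ik mu u0.
pose Y w := (Xs i w, Xs k w).
have mY : measurable_fun setT Y.
  by apply/measurable_fun_pairP; split.
pose Ymix := isMeasurableFun.Build _ _ _ _ Y mY.
pose YRV : {RV P >-> (S * S)%type} := HB.pack Y Ymix.
pose D := distribution P X.
have YD (A B : set S) : measurable A -> measurable B ->
    distribution P YRV (A `*` B) = (D A * D B)%E.
  move=> mA mB.
  (* Independence is stated for families of sets indexed by all naturals; on the list [[:: i; k]]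
     only the values at [i] and [k] count. *)
  pose C j := if j == i then A else B.
  have mC j : measurable (C j) by rewrite /C; case: ifP.
  have := Xs_iid.1 [:: i; k] C; rewrite /= inE ik => /(_ isT mC).
  rewrite !big_cons big_nil mule1 /C eqxx eq_sym (negbTE ik).
  have := Xs_iid.2 i A mA; have := Xs_iid.2 k B mB.
  rewrite /D /distribution /pushforward /= => -> -> <-.
  congr (P _); apply/seteqP; split => w /=.
    move=> [Aw Bw] j /=; rewrite !inE => /orP[/eqP->|/eqP->]; rewrite ?eqxx//.
    by rewrite eq_sym (negbTE ik).
  move=> H; split.
    by have := H i; rewrite /= !inE !eqxx/=; exact.
  by have := H k; rewrite /= !inE !eqxx eq_sym (negbTE ik) ?orbT/=; exact.
pose h (z : S * S) := (u z.1 * u z.2)%E.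
have mh : measurable_fun setT h.
  by apply: emeasurable_funM; apply: measurableT_comp.
have h0 z : (0 <= h z)%E by rewrite mule_ge0.
transitivity (\int[distribution P YRV]_z h z)%E.
  by rewrite ge0_integral_distribution.
transitivity (\int[(D \x D)%E]_z h z)%E.
  apply: eq_measure_integral => A mA _; symmetry.
  exact: (@product_measure_unique _ _ _ _ _ D D (distribution P YRV)).
rewrite fubini_tonelli1// /fubini_F /h /=.
under eq_integral => x _ do rewrite ge0_integralZl//.
rewrite ge0_integralZr//; last by apply: integral_ge0.
by rewrite !ge0_integral_distribution.
Qed.

Lemma integral_cst_probability (r : R) : (\int[P]_w r%:E = r%:E)%E.
Proof. by rewrite integral_cst//= probability_setT mule1. Qed.

(** The variance of a sum of pairwise uncorrelated variables is the sum of the variances, and a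
    variance is at most the second moment. The bound [K] makes all the integrals finite. *)
Lemma second_moment_iid (u : S -> R) (K mu : R) (N : nat) :
  measurable_fun setT u -> (forall x, 0 <= u x <= K) ->
  (\int[P]_w (u (X w))%:E)%E = mu%:E ->
  (\int[P]_w ((\sum_(i < N) u (Xs i w) - N%:R * mu) ^+ 2)%:E <=
   N%:R%:E * \int[P]_w (u (X w) ^+ 2)%:E)%E.
Proof.
move=> mu_ uK muE.
have u0 x : 0 <= u x by have /andP[] := uK x.
have uleK x : u x <= K by have /andP[] := uK x.
have mEu : measurable_fun setT (EFin \o u) by exact/measurable_EFinP.
have mX (v : S -> R) : measurable_fun setT v ->
    measurable_fun setT (fun w => (v (X w))%:E).
  by move=> mv; apply/measurable_EFinP; apply: measurableT_comp.
have mXs i (v : S -> R) : measurable_fun setT v ->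
    measurable_fun setT (fun w => v (Xs i w)).
  by move=> mv; apply: measurableT_comp.
have bnd (v : S -> R) L : measurable_fun setT v ->
    (forall x, 0 <= v x <= L) ->
    (\int[P]_w (v (X w))%:E)%E \is a fin_num.
  move=> mv vL; rewrite ge0_fin_numE; last first.
    by apply: integral_ge0 => w _; rewrite lee_fin; case/andP: (vL (X w)).
  apply: (@le_lt_trans _ _ (\int[P]_w L%:E)%E).
    apply: ge0_le_integral => //.
    - by move=> w _; rewrite lee_fin; case/andP: (vL (X w)).
    - exact: mX.
    - by move=> w _; rewrite lee_fin; case/andP: (vL (X w)).
  by rewrite integral_cst_probability ltry.
have mu0 : 0 <= mu.
  by rewrite -lee_fin -muE; apply: integral_ge0 => w _; rewrite lee_fin.
have m2 : measurable_fun setT (fun x => u x ^+ 2) by exact: measurable_funX.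
have : (\int[P]_w (u (X w) ^+ 2)%:E)%E \is a fin_num.
  apply: (bnd (fun x => u x ^+ 2) (K ^+ 2)) => // x.
  by rewrite exprn_ge0//= lerXn2r// nnegrE (le_trans (u0 x)).
move/fineK => aE; set a := fine _ in aE; rewrite -aE.
have a0 : 0 <= a.
  by rewrite -lee_fin aE; apply: integral_ge0 => w _; rewrite lee_fin exprn_ge0.
set Sm := fun w => \sum_(i < N) u (Xs i w).
have mS : measurable_fun setT Sm.
  by apply: measurable_sum => i; exact: mXs.
have S0 w : 0 <= Sm w by apply: sumr_ge0.
have ES : (\int[P]_w (Sm w)%:E)%E = (N%:R * mu)%:E.
  under eq_integral do rewrite -sumEFin.
  rewrite ge0_integral_sum//; last 2 first.
  - by move=> i; apply/measurable_EFinP; exact: mXs.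
  - by move=> i w _; rewrite lee_fin.
  under eq_bigr => i _ do rewrite (integral_iid i mEu) ?muE//.
  by rewrite sumEFin sumr_const card_ord mulr_natl.
have ES2 : (\int[P]_w (Sm w ^+ 2)%:E <=
    (N%:R * a + (N%:R * mu) ^+ 2)%:E)%E.
  have S2E w : (Sm w ^+ 2)%:E =
      (\sum_(z : 'I_N * 'I_N) (u (Xs z.1 w) * u (Xs z.2 w))%:E)%E.
    rewrite sumEFin; congr EFin.
    rewrite expr2 /Sm big_distrlr/= pair_big/=.
    by apply: eq_bigr.
  under eq_integral do rewrite S2E.
  rewrite ge0_integral_sum//; last 2 first.
  - by move=> z; apply/measurable_EFinP; apply: measurable_funM; exact: mXs.
  - by move=> z w _; rewrite lee_fin mulr_ge0.
  (* The products have mean [mu ^+ 2] off the diagonal and [a] on it; allowing an extra [mu ^+ 2] on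
     the diagonal gives an upper bound with this closed form. *)
  have -> : N%:R * a + (N%:R * mu) ^+ 2 =
      \sum_(z : 'I_N * 'I_N) ((if z.1 == z.2 then a else 0) + mu ^+ 2).
    rewrite big_split/= sumr_const card_prod card_ord; congr +%R; last first.
      by rewrite exprMn -natrX mulr_natl mulnn.
    rewrite -(pair_big xpredT xpredT (fun i j => if i == j then a else 0))/=.
    under eq_bigr => i _ do rewrite -big_mkcond (eq_bigl _ _ (eq_sym i)) big_pred1_eq.
    by rewrite sumr_const card_ord mulr_natl.
  rewrite -sumEFin; apply: lee_sum => -[i k] _ /=.
  have [->|ik] := eqVneq i k.
    under eq_integral do rewrite -expr2.
    rewrite (integral_iid k (u := fun x => (u x ^+ 2)%:E)).
    - by rewrite -aE lee_fin lerDl exprn_ge0.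
    - exact/measurable_EFinP.
    - by move=> x; rewrite lee_fin exprn_ge0.
  under eq_integral do rewrite EFinM.
  by rewrite (integral_iid_mul (u := fun x => (u x)%:E)) ?muE ?add0r.
have N0 : 0 <= N%:R * mu by rewrite mulr_ge0.
(* The expanded square with its cross term moved across, so that all integrands are nonnegative and
   the integral is additive. *)
have : (\int[P]_w ((Sm w - N%:R * mu) ^+ 2)%:E +
    \int[P]_w (2 * (N%:R * mu) * Sm w)%:E =
    \int[P]_w (Sm w ^+ 2)%:E + \int[P]_w ((N%:R * mu) ^+ 2)%:E)%E.
  rewrite -!ge0_integralD//.
  - by apply: eq_integral => w _; rewrite -!EFinD; congr EFin; ring.
  - by move=> w _; rewrite lee_fin exprn_ge0.
  - by apply/measurable_EFinP; exact: measurable_funX.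
  - by move=> w _; rewrite lee_fin exprn_ge0.
  - by move=> w _; rewrite lee_fin exprn_even_ge0.
  - by apply/measurable_EFinP/measurable_funX/measurable_funB.
  - by move=> w _; rewrite lee_fin !mulr_ge0.
  - by apply/measurable_EFinP/measurable_funM.
under [X in (_ + X = _)%E]eq_integral do rewrite EFinM.
rewrite ge0_integralZl//; last 3 first.
- exact/measurable_EFinP.
- by move=> w _; rewrite lee_fin.
- by rewrite lee_fin mulr_ge0.
rewrite ES integral_cst_probability => E.
have {E}ES2 : (\int[P]_w ((Sm w - N%:R * mu) ^+ 2)%:E +
    (2 * (N%:R * mu) * (N%:R * mu))%:E <=
    (N%:R * a + (N%:R * mu) ^+ 2 + (N%:R * mu) ^+ 2)%:E)%E.
  by rewrite EFinM E EFinD leeD2r.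
move: ES2; rewrite -leeBrDr// => /le_trans; apply.
rewrite -EFinB -EFinM lee_fin; lra.
Qed.

Lemma measurable_set_lt (f g : T -> R) :
  measurable_fun setT f -> measurable_fun setT g ->
  measurable [set w | f w < g w].
Proof.
move=> mf mg; rewrite (_ : mkset _ = ~` [set w | g w <= f w]); last first.
  by apply/seteqP; split=> w /=; rewrite ltNge; move/negP.
apply: measurableC; rewrite -[X in measurable X]setTI.
exact: measurable_fun_le.
Qed.

Lemma chebyshev_sq (f : T -> R) (r b : R) : measurable_fun setT f -> 0 < r ->
  (\int[P]_w (f w ^+ 2)%:E <= b%:E)%E ->
  (P [set w | (r <= `|f w|)%R] <= (r ^- 2 * b)%:E)%E.
Proof.
move=> mf r0 fb.
have mA : measurable [set w | (r <= `|f w|)%R].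
  rewrite -[X in measurable X]setTI.
  by apply: measurable_fun_le => //; exact: measurableT_comp.
have r20 : 0 < r ^+ 2 by rewrite exprn_gt0.
rewrite EFinM lee_pdivlMl// (le_trans _ fb)//.
have -> : ((r ^+ 2)%:E * P [set w | (r <= `|f w|)%R] =
    \int[P]_w ((r ^+ 2)%:E * (\1_[set w | (r <= `|f w|)%R] w)%:E))%E.
  rewrite ge0_integralZl ?integral_indic ?setIT//.
  - by apply/measurable_EFinP; exact: measurable_indic.
  - by rewrite lee_fin ltW.
apply: ge0_le_integral => //.
- by move=> w _; rewrite -EFinM lee_fin mulr_ge0// ltW.
- apply/measurable_EFinP/measurable_funM => //; exact: measurable_indic.
- by apply/measurable_EFinP; exact: measurable_funX.
- move=> w _; rewrite -EFinM lee_fin indicE.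
  have [|_] := boolP (w \in _); last by rewrite mulr0 exprn_even_ge0.
  rewrite inE/= mulr1 => rf; rewrite -[leRHS]real_normK ?num_real//.
  by rewrite lerXn2r// nnegrE// ltW.
Qed.

(** With [N = c * 2 ^ j] and [a] the second moment of the variable capped at [2 ^ j], Chebyshev
    bounds the chance that some sample reaches the cap by [N * 4 ^- j * a = c * 2 ^- j * a], and the
    chance that the capped sum deviates by [N * e] by [a / (N * e ^+ 2) = 2 ^- j * a / (c * e ^+
    2)]. *)
Lemma dyadic_deviation_iid (u : S -> R) (m e : R) (c j : nat) :
  measurable_fun setT u -> (forall x, 0 <= u x) ->
  (\int[P]_w (u (X w))%:E)%E = m%:E -> (0 < c)%N -> 0 < e ->
  (P [set w | ((c * 2 ^ j)%:R * (m + e) < \sum_(i < c * 2 ^ j) u (Xs i w))%R] <=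
   (c%:R + (c%:R * e ^+ 2)^-1)%:E *
   \int[P]_w (2 ^- j * Order.min (u (X w)) (2 ^+ j) ^+ 2)%:E)%E.
Proof.
move=> mu u0 um c0 e0; set N := (c * 2 ^ j)%N.
have p0 : 0 < (2 : R) ^+ j by rewrite exprn_gt0.
have NE : N%:R = c%:R * 2 ^+ j :> R by rewrite natrM natrX.
have N0 : 0 < N%:R :> R by rewrite NE mulr_gt0// ltr0n.
pose v x := Order.min (u x) (2 ^+ j).
have mv : measurable_fun setT v by exact: measurable_minr.
have v0 x : 0 <= v x <= 2 ^+ j by rewrite le_min u0 ltW//= ge_min lexx orbT.
have v0' x : 0 <= v x by case/andP: (v0 x).
have mvX : measurable_fun setT (fun w => v (X w)) by exact: measurableT_comp.
have muX : measurable_fun setT (fun w => u (X w)) by exact: measurableT_comp.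
have mvXs i : measurable_fun setT (fun w => v (Xs i w)).
  exact: measurableT_comp.
have muXs i : measurable_fun setT (fun w => u (Xs i w)).
  exact: measurableT_comp.
have Ev : (\int[P]_w (v (X w))%:E <= m%:E)%E.
  rewrite -um; apply: ge0_le_integral => //.
  - by move=> w _; rewrite lee_fin.
  - exact/measurable_EFinP.
  - exact/measurable_EFinP.
  - by move=> w _; rewrite lee_fin ge_min lexx.
have /fineK mvE : (\int[P]_w (v (X w))%:E)%E \is a fin_num.
  rewrite ge0_fin_numE ?(le_lt_trans Ev) ?ltry//.
  by apply: integral_ge0 => w _; rewrite lee_fin.
move: mvE; set n := fine _ => mvE.
have nm : n <= m by rewrite -lee_fin mvE.
have Ea : (\int[P]_w (v (X w) ^+ 2)%:E <= ((2 ^+ j) ^+ 2)%:E)%E.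
  rewrite -[leRHS]integral_cst_probability; apply: ge0_le_integral => //.
  - by move=> w _; rewrite lee_fin exprn_ge0.
  - by apply/measurable_EFinP; exact: measurable_funX.
  - move=> w _; have /andP[vw vj] := v0 (X w).
    by rewrite lee_fin lerXn2r// nnegrE// ltW.
have /fineK aE : (\int[P]_w (v (X w) ^+ 2)%:E)%E \is a fin_num.
  rewrite ge0_fin_numE ?(le_lt_trans Ea) ?ltry//.
  by apply: integral_ge0 => w _; rewrite lee_fin exprn_ge0.
move: aE; set a := fine _ => aE.
have -> : (\int[P]_w (2 ^- j * Order.min (u (X w)) (2 ^+ j) ^+ 2)%:E =
    (2 ^- j * a)%:E)%E.
  rewrite EFinM aE -ge0_integralZl//.
  - by apply/measurable_EFinP; exact: measurable_funX.
  - by move=> w _; rewrite lee_fin exprn_ge0.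
pose A i := [set w | 2 ^+ j <= `|v (Xs i w)|].
pose B := [set w | N%:R * e <= `|\sum_(i < N) v (Xs i w) - N%:R * n|].
have mA i : measurable (A i).
  rewrite -[X in measurable X]setTI.
  by apply: measurable_fun_le => //; exact: measurableT_comp.
have mB : measurable B.
  rewrite -[X in measurable X]setTI.
  apply: measurable_fun_le => //; apply: measurableT_comp => //.
  by apply: measurable_funB => //; exact: measurable_sum.
have PA i : (P (A i) <= ((2 ^+ j) ^- 2 * a)%:E)%E.
  apply: chebyshev_sq => //.
  rewrite (integral_iid i (u := fun x => (v x ^+ 2)%:E)) ?aE//.
  - by apply/measurable_EFinP; exact: measurable_funX.
  - by move=> x; rewrite lee_fin exprn_ge0.
have PB : (P B <= ((N%:R * e) ^- 2 * (N%:R * a))%:E)%E.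
  apply: chebyshev_sq => //.
  - by apply: measurable_funB => //; exact: measurable_sum.
  - by rewrite mulr_gt0.
  - by rewrite EFinM aE; exact: (second_moment_iid _ mv v0).
(* Off every [A i] capping changes nothing, and the capped mean [n] is at most [m], so an excess of
   the original sum is a deviation of the capped one. *)
have sub : [set w | (N%:R * (m + e) < \sum_(i < N) u (Xs i w))%R] `<=`
    \big[setU/set0]_(i < N) A i `|` B.
  move=> w /= uw; apply: contrapT => /not_orP[nA nB].
  have uv i : (i < N)%N -> u (Xs i w) = v (Xs i w).
    move=> iN; apply/esym/min_idPl; rewrite leNgt; apply/negP => uj.
    apply: nA; rewrite -bigcup_mkord; exists i => //=.
    by rewrite /A/= ger0_norm// /v min_r ?lexx// ltW.
  apply: nB; rewrite /B/=; move: uw.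
  under eq_bigr => i _ do rewrite uv ?ltn_ord//.
  move=> uw; apply: le_trans (ler_norm _); rewrite lerBrDr.
  apply: le_trans (ltW uw); rewrite -mulrDr ler_pM2l//; lra.
have mBig : measurable (\big[setU/set0]_(i < N) A i) by exact: bigsetU_measurable.
have mD : measurable [set w | (N%:R * (m + e) < \sum_(i < N) u (Xs i w))%R].
  by apply: measurable_set_lt => //; exact: measurable_sum.
apply: (@le_trans _ _ (P (\big[setU/set0]_(i < N) A i `|` B))).
  by apply: le_measure => //; rewrite inE//; exact: measurableU.
apply: (le_trans (measureU2 _ _ _)) => //.
apply: (@le_trans _ _ (\sum_(i < N) ((2 ^+ j) ^- 2 * a)%:E +
    ((N%:R * e) ^- 2 * (N%:R * a))%:E)%E).
  apply: leeD => //.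
  apply: (@le_trans _ _ (\sum_(i < N) P (A i))%E); last exact: lee_sum.
  exact: Boole_inequality.
rewrite sumEFin sumr_const card_ord -EFinD -EFinM lee_fin -[_ *+ N]mulr_natl NE.
set q := 2 ^+ j in p0 *.
rewrite le_eqVlt; apply/orP; left; apply/eqP; field.
by rewrite !gt_eqF ?ltr0n.
Qed.

(** Borel-Cantelli: by [dyadic_truncation_sum] under the integral, the deviation probabilities sum
    to at most a constant times [4 * m]. *)
Lemma slln_dyadic_iid (u : S -> R) (m e : R) (c : nat) :
  measurable_fun setT u -> (forall x, 0 <= u x) ->
  (\int[P]_w (u (X w))%:E)%E = m%:E -> (0 < c)%N -> 0 < e ->
  {ae P, forall w, \forall j \near \oo,
    \sum_(i < c * 2 ^ j) u (Xs i w) <= (c * 2 ^ j)%:R * (m + e)}.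
Proof.
move=> mu u0 um c0 e0.
pose D j := [set w | (c * 2 ^ j)%:R * (m + e) <
  \sum_(i < c * 2 ^ j) u (Xs i w)].
have mD j : measurable (D j).
  apply: measurable_set_lt => //.
  by apply: measurable_sum => i; exact: measurableT_comp.
exists (lim_sup_set D); split.
- apply: bigcap_measurable; first by exists 0%N.
  by move=> k _; apply: bigcup_measurable.
- apply: lim_sup_set_cvg0 => //.
  pose K := c%:R + (c%:R * e ^+ 2)^-1 : R.
  have K0 : 0 <= K by rewrite addr_ge0// invr_ge0 mulr_ge0// exprn_ge0// ltW.
  pose f j w := (2 ^- j * Order.min (u (X w)) (2 ^+ j) ^+ 2)%:E.
  have f0 j w : (0 <= f j w)%E.
    by rewrite lee_fin mulr_ge0 ?invr_ge0 ?exprn_ge0// le_min u0 exprn_ge0.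
  have mf j : measurable_fun setT (f j).
    apply/measurable_EFinP/measurable_funM => //; apply: measurable_funX.
    by apply: measurable_minr => //; exact: measurableT_comp.
  apply: (@le_lt_trans _ _ (K%:E * (4 * m)%:E)%E); last by rewrite ltry.
  apply: (@le_trans _ _ (\sum_(0 <= j <oo) K%:E * \int[P]_w f j w)%E).
    apply: lee_nneseries => [j _ _|j _]; first exact: measure_ge0.
    exact: dyadic_deviation_iid.
  rewrite nneseriesZl; last by move=> j _; exact: integral_ge0.
  rewrite lee_wpmul2l ?lee_fin//.
  rewrite -integral_nneseries//.
  apply: (@le_trans _ _ (\int[P]_w (4%:E * (u (X w))%:E))%E).
    apply: ge0_le_integral => //.
    - by move=> w _; exact: nneseries_ge0.
    - by apply: ge0_emeasurable_sum => // k w _ _; exact: f0.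
    - apply: measurable_funeM; apply/measurable_EFinP.
      exact: measurableT_comp.
    - move=> w _; apply: lime_le.
        by apply: is_cvg_nneseries => k _ _.
      apply: nearW => k; rewrite big_mkord sumEFin -EFinM lee_fin.
      exact: dyadic_truncation_sum.
  rewrite ge0_integralZl ?um//.
  - by apply/measurable_EFinP; exact: measurableT_comp.
  - by move=> w _; rewrite lee_fin.
- move=> w /= nw k _; apply: contrapT => nk; apply: nw.
  exists k => // j /= kj; rewrite leNgt; apply/negP => jD.
  by apply: nk; exists j.
Qed.

(** Countably many pairs of a multiplier and an accuracy [l.+1%:R^-1] share one null set; off it the
    interpolation between dyadic sizes is deterministic. *)
Lemma slln_ub_iid (u : S -> R) (m : R) :
  measurable_fun setT u -> (forall x, 0 <= u x) ->
  (\int[P]_w (u (X w))%:E)%E = m%:E ->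
  {ae P, forall w, forall e, 0 < e -> \forall k \near \oo,
    \sum_(i < k) u (Xs i w) <= k%:R * (m + e)}.
Proof.
move=> mu u0 um.
have m0 : 0 <= m.
  by rewrite -lee_fin -um; apply: integral_ge0 => w _; rewrite lee_fin.
have : {ae P, forall w, forall c l : nat, \forall j \near \oo,
    \sum_(i < c.+1 * 2 ^ j) u (Xs i w) <=
      (c.+1 * 2 ^ j)%:R * (m + l.+1%:R^-1)}.
  by apply: ae_foralln => c; apply: ae_foralln => l; exact: slln_dyadic_iid.
apply: filterS => w H e e0.
apply: (sum_dyadic_interpolation (z := fun i => u (Xs i w))) => //.
by case=> // c l _; exact: H.
Qed.

(** For a bounded variable, the upper bound applied to [K - u] is a lower bound for [u]. *)
Lemma slln_lb_iid (u : S -> R) (K m : R) :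
  measurable_fun setT u -> (forall x, 0 <= u x <= K) ->
  (\int[P]_w (u (X w))%:E)%E = m%:E ->
  {ae P, forall w, forall e, 0 < e -> \forall k \near \oo,
    k%:R * (m - e) <= \sum_(i < k) u (Xs i w)}.
Proof.
move=> mu uK um.
have u0 x : 0 <= u x by have /andP[] := uK x.
have Ku0 x : 0 <= K - u x by rewrite subr_ge0; case/andP: (uK x).
have mKu : measurable_fun setT (fun x => K - u x) by exact: measurable_funB.
have KuE : (\int[P]_w (K - u (X w))%:E = (K - m)%:E)%E.
  apply/eqP; rewrite EFinB -um eq_sym sube_eq ?um//; last first.
    by apply: fin_num_adde_defl.
  rewrite -um -ge0_integralD//.
  - by under eq_integral do rewrite -EFinD subrK; rewrite integral_cst_probability.
  - by move=> w _; rewrite lee_fin.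
  - by apply/measurable_EFinP; exact: measurableT_comp mKu _.
  - by move=> w _; rewrite lee_fin.
  - by apply/measurable_EFinP; exact: measurableT_comp.
have := slln_ub_iid mKu Ku0 KuE.
apply: filterS => w H e e0; apply: filterS (H e e0) => k.
rewrite sumrB sumr_const card_ord -mulr_natl lerBlDr => /le_trans.
move=> Hk; have := Hk _ (lexx _); lra.
Qed.

End IidIntegrals.

(** * Consistency of M-estimators on a compact space *)

(** Without a minimiser, each [y] is beaten by some [z], which by lower semicontinuity also beats a
    neighbourhood of [y]. Compactness yields one [z] that beats every point, itself included. *)
Lemma lsc_compact_argmin (R : realType) (M : ptopologicalType)
  (F : M -> \bar R) : compact [set: M] ->
  (forall y z, (F z < F y)%E -> \forall x \near y, (F z < F x)%E) ->
  argmin F !=set0.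
Proof.
move=> cM lscF; apply: contrapT => /forallNP noargmin.
(* The filter generated by the sublevel sets of [F], which are nested: eventual along [G] means for
   all points low enough. *)
pose G : set_system M := filter_from setT (fun z => [set x | (F x <= F z)%E]).
have FG : Filter G.
  apply: filter_from_filter; first by exists point.
  move=> i j _ _; have [ij|ji] := leP (F i) (F j).
    by exists i => // x /= xi; split=> //; exact: le_trans ij.
  by exists j => // x /= xj; split=> //; apply: le_trans xj (ltW ji).
have /compact_near_coveringP/(_ M G (fun z x => (F z < F x)%E)) := cM.
case=> [y _|z _ H].
  have /existsNP[z /negP] := noargmin y; rewrite -ltNge => zy.
  exists ([set x | (F z < F x)%E], [set x | (F x <= F z)%E]) => /=.
    by split; [exact: lscF|exists z].
  by move=> -[a b] /= [za bz]; exact: le_lt_trans za.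
by have := H z (lexx _) z Logic.I; rewrite ltxx.
Qed.

(** Joint continuity gives the estimate on a product neighbourhood of each [(x, y)]; compactness in
    [x] leaves a single neighbourhood of [y]. *)
Lemma compact_equicontinuous (R : realType) (M : topologicalType)
  (f : M -> M -> R) : compact [set: M] ->
  continuous (fun z : M * M => f z.1 z.2) ->
  forall y (e : R), 0 < e ->
    \forall z \near y, forall x, `|f x z - f x y| < e.
Proof.
move=> cM cf y e e0.
have Fy : Filter (nbhs y) by exact: nbhs_filter.
have /compact_near_coveringP/(_ M (nbhs y)
  (fun z x => `|f x z - f x y| < e) Fy) := cM.
move=> near_y; apply: filterS (near_y _) => [z zP x|x _]; first exact: zP.
have e20 : 0 < e / 2 by rewrite divr_gt0.
have /cvgrPdist_lt/(_ _ e20) [[A B] /= [Ax By] AB] := cf (x, y).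
exists (A, B) => // -[a b] /= [Aa Bb].
have := AB (a, b) (conj Aa Bb); have := AB (a, y) (conj Aa (nbhs_singleton By)).
rewrite /= => h1 h2.
rewrite (_ : f a b - f a y = (f x y - f a y) - (f x y - f a b)); last by ring.
by rewrite (le_lt_trans (ler_normB _ _))// [ltRHS]splitr ltrD.
Qed.

Lemma continuous_slice (R : realType) (M : topologicalType)
  (f : M -> M -> R) : continuous (fun z : M * M => f z.1 z.2) ->
  forall y, continuous (fun x => f x y).
Proof.
move=> cf y x.
apply: (@continuous_comp _ _ _ (fun x => (x, y)) (fun z : M * M => f z.1 z.2)).
  by apply: cvg_pair => //; exact: cvg_cst.
exact: cf.
Qed.

Lemma borel_measurable_continuous (R : realType) (M : ptopologicalType)
  (u : M -> R) : continuous u -> measurable_fun [set: borel M] u.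
Proof.
move=> /continuousP cu.
apply: (measurability _ (RGenOInfty.measurableE R)).
move=> _ [_ [a ->] <-]; rewrite setTI; apply: sub_sigma_algebra.
exact: (cu _ (itv_open_ends_open _)).
Qed.

(** Each point has a neighbourhood that lies in [O], if the point is in [A], or else misses all
    [E m] from some index on; compactness makes the index common. *)
Lemma eventually_subset_of_closure (M : topologicalType) (E : nat -> set M)
  (A O : set M) : compact [set: M] ->
  \bigcap_(k in [set k | (0 < k)%N])
    closure (\bigcup_(m in [set m | (k <= m)%N]) E m) `<=` A ->
  (forall x, A x -> nbhs x O) ->
  exists k, (0 < k)%N /\ \bigcup_(m in [set m | (k <= m)%N]) E m `<=` O.
Proof.
move=> cM EA AO.
have Foo : Filter \oo by exact: eventually_filter.
have /compact_near_coveringP/(_ nat \oo (fun n x =>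
  (\bigcup_(m in [set m | (n <= m)%N]) E m) x -> O x) Foo) := cM.
case=> [x _|k _ H]; last first.
  exists k.+1; split => // x Ex; apply: (H k.+1) => //=; exact: leqnSn.
have [Ax|nAx] := pselect (A x).
  exists (O, setT); first by split; [exact: AO|exact: filterT].
  by move=> [a b] /= [].
have /existsNP[k /not_implyP[k0]] : ~ (\bigcap_(k in [set k | (0 < k)%N])
    closure (\bigcup_(m in [set m | (k <= m)%N]) E m)) x by move/EA.
move/existsNP => [V /not_implyP[xV VE]].
exists (V, [set n | (k <= n)%N]); first by split => //; exists k.
move=> [a n] /= [Va kn] [m /= nm Em]; exfalso; apply: VE.
by exists a; split => //; exists m => //=; exact: leq_trans nm.
Qed.

Section MEstimators.
Context (R : realType) (M : ptopologicalType).
Context (d : measure_display) (T : measurableType d) (P : probability T R).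
Context (X : {RV P >-> borel M}) (Xs : nat -> {RV P >-> borel M}).
Hypothesis M_compact : compact [set: M].
Hypothesis Xs_iid : iid_samples X Xs.

(** * Uniform lower law of large numbers for bounded continuous losses *)

Section UniformLowerBound.
Variables (f : M -> M -> R) (K : R).
Hypothesis f_cont : continuous (fun z : M * M => f z.1 z.2).
Hypothesis f_bnd : forall x y, 0 <= f x y <= K.

Let f_mean y := fine (\int[P]_w (f (X w) y)%:E)%E.

Lemma measurable_slice y : measurable_fun [set: borel M] (f^~ y).
Proof.
apply: borel_measurable_continuous; exact: (@continuous_slice R M f f_cont y).
Qed.

Lemma measurable_slice_RV y (Y : {RV P >-> borel M}) :
  measurable_fun setT (fun w => (f (Y w) y)%:E).
Proof.
by apply/measurable_EFinP; exact: measurableT_comp (measurable_slice y) _.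
Qed.

Lemma f_meanE y : (\int[P]_w (f (X w) y)%:E = (f_mean y)%:E)%E.
Proof.
rewrite fineK// ge0_fin_numE; last first.
  by apply: integral_ge0 => w _; rewrite lee_fin; case/andP: (f_bnd (X w) y).
apply: (@le_lt_trans _ _ (\int[P]_w K%:E)%E).
  apply: ge0_le_integral => //.
  - by move=> w _; rewrite lee_fin; case/andP: (f_bnd (X w) y).
  - exact: measurable_slice_RV.
  - by move=> w _; rewrite lee_fin; case/andP: (f_bnd (X w) y).
by rewrite integral_cst_probability ltry.
Qed.

Lemma f_mean_le y z e : 0 <= e -> (forall x, f x y <= f x z + e) ->
  f_mean y <= f_mean z + e.
Proof.
move=> e0 yz; rewrite -lee_fin EFinD -!f_meanE.
have f0 x v : (0 <= (f x v)%:E)%E by rewrite lee_fin; case/andP: (f_bnd x v).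
rewrite -(integral_cst_probability P e) -ge0_integralD//; last first.
  exact: measurable_slice_RV.
apply: ge0_le_integral => //; first exact: measurable_slice_RV.
- by apply: emeasurable_funD => //; exact: measurable_slice_RV.
- by move=> w _; rewrite -EFinD lee_fin.
Qed.

(** The modulus in the second variable is uniform in [x], so it survives integration. *)
Lemma f_mean_equicontinuous y e : 0 < e ->
  \forall z \near y, (forall x, `|f x z - f x y| < e) /\
    `|f_mean z - f_mean y| <= e.
Proof.
move=> e0; apply: filterS (compact_equicontinuous M_compact f_cont y e0) => z zy.
split => //; rewrite ler_distl lerBlDr; apply/andP; split.
- apply: f_mean_le (ltW e0) _ => x; have := zy x; rewrite ltr_distlC => /andP[_ /ltW].
  by [].
- apply: f_mean_le (ltW e0) _ => x; have := zy x; rewrite ltr_distl => /andP[_ /ltW].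
  by [].
Qed.

Lemma uniform_slln_lb :
  {ae P, forall w, forall e, 0 < e -> \forall k \near \oo, forall y,
    k%:R * (f_mean y - e) <= \sum_(i < k) f (Xs i w) y}.
Proof.
have : {ae P, forall w, forall l : nat, \forall k \near \oo, forall y,
    k%:R * (f_mean y - l.+1%:R^-1) <= \sum_(i < k) f (Xs i w) y}.
  apply: ae_foralln => l.
  (* One third each for the law of large numbers at a net point, for moving the empirical mean to
     that point, and for moving [f_mean]. *)
  pose e : R := l.+1%:R^-1 / 3.
  have e0 : 0 < e by rewrite divr_gt0.
  pose N y := interior [set z | (forall x, `|f x z - f x y| < e) /\
    `|f_mean z - f_mean y| <= e].
  have cover_M : [set: M] `<=` cover setT N.
    by move=> y _; exists y => //; exact: f_mean_equicontinuous.
  have := M_compact; rewrite compact_cover => /(_ M setT N) [].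
  - by move=> i _; exact: open_interior.
  - exact: cover_M.
  move=> D _ DM.
  pose s : seq M := D.
  (* Indexing the net by all naturals, with default [point], makes this a countable intersection of
     almost sure events; only indices below [size s] are used afterwards. *)
  have : {ae P, forall w, forall i : nat, forall e, 0 < e ->
      \forall k \near \oo,
        k%:R * (f_mean (nth point s i) - e) <=
          \sum_(j < k) f (Xs j w) (nth point s i)}.
    apply: ae_foralln => i.
    apply: (slln_lb_iid Xs_iid (u := f^~ (nth point s i)) (K := K)) => //.
    - exact: measurable_slice.
    - exact: f_meanE.
  apply: filterS => w H.
  have {}H : \forall k \near \oo, forall i : 'I_(size s),
      k%:R * (f_mean (nth point s i) - e) <=
        \sum_(j < k) f (Xs j w) (nth point s i).
    by apply: filter_forall => i; exact: H.
  apply: filterS H => k H z.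
  have [y /= yD /interior_subset[/= fzy mzy]] := DM z Logic.I.
  have ys : (index y s < size s)%N by rewrite index_mem.
  have := H (Ordinal ys); rewrite /= nth_index// => {}H.
  have : \sum_(j < k) f (Xs j w) y - k%:R * e <= \sum_(j < k) f (Xs j w) z.
    rewrite mulr_natl -[X in _ *+ X](card_ord k) -sumr_const -sumrB.
    by apply: ler_sum => j _; have := fzy (Xs j w); rewrite ltr_distl => /andP[/ltW].
  apply: le_trans; rewrite lerBrDr; apply: le_trans H.
  rewrite -mulrDr ler_wpM2l//.
  move: mzy; rewrite ler_distl => /andP[_].
  have : l.+1%:R^-1 = e + e + e by rewrite /e; field.
  by move=> ->; move: (e) (f_mean z) (f_mean y) => a b c; lra.
apply: filterS => w H e e0.
pose l := Num.truncn e^-1.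
have le : l.+1%:R^-1 <= e.
  by rewrite invf_ple ?posrE// ltW// truncnS_gt.
apply: filterS (H l) => k Hk y; apply: le_trans (Hk y).
by rewrite ler_wpM2l// lerB.
Qed.

End UniformLowerBound.

(** * Increasing limits of bounded continuous losses *)

Section Ziezold.
Variables (phi : nat -> M -> M -> R) (h : M -> M -> \bar R).
Hypothesis phi_cont : forall k, continuous (fun z : M * M => phi k z.1 z.2).
Hypothesis phi_bnd : forall k x y, 0 <= phi k x y <= k%:R.
Hypothesis phi_nd : forall x y, {homo (phi^~ x)^~ y : k l / (k <= l)%N >-> k <= l}.
Hypothesis phi_cvg : forall x y, (phi k x y)%:E @[k --> \oo] --> h x y.

Let F y := (\int[P]_w h (X w) y)%E.
Let Fk k y := fine (\int[P]_w (phi k (X w) y)%:E)%E.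

Let phi_le k x y : ((phi k x y)%:E <= h x y)%E.
Proof.
have hE := cvg_lim (@ereal_hausdorff R) (phi_cvg (x := x) (y := y)).
rewrite -hE; apply: lime_ge; first by apply/cvg_ex; eexists; exact: phi_cvg.
by exists k => // l /= kl; rewrite lee_fin; exact: phi_nd.
Qed.

Let h_ge0 x y : (0 <= h x y)%E.
Proof.
by apply: le_trans (phi_le 0 x y); rewrite lee_fin; case/andP: (phi_bnd 0 x y).
Qed.

Lemma measurable_limit_slice y : measurable_fun [set: borel M] (h^~ y).
Proof.
apply: (emeasurable_fun_cvg (fun k (x : borel M) => (phi k x y)%:E)) => [k|x _].
  by apply/measurable_EFinP; exact: (@measurable_slice (phi k) (@phi_cont k) y).
exact: phi_cvg.
Qed.

Let measurable_h_RV y (Y : {RV P >-> borel M}) :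
  measurable_fun setT (fun w => h (Y w) y).
Proof. exact: measurableT_comp (measurable_limit_slice y) _. Qed.

Let F_cvg y : (Fk k y)%:E @[k --> \oo] --> F y.
Proof.
have -> : F y = (\int[P]_w limn (fun k => (phi k (X w) y)%:E))%E.
  apply: eq_integral => w _; symmetry.
  exact: (cvg_lim (@ereal_hausdorff R) (@phi_cvg (X w) y)).
under eq_fun => k do rewrite -(f_meanE (@phi_cont k) (phi_bnd k)).
apply: cvg_monotone_convergence => //.
- by move=> k; exact: (@measurable_slice_RV (phi k) (@phi_cont k) y).
- by move=> k w _; rewrite lee_fin; case/andP: (phi_bnd k (X w) y).
- by move=> w _ k l kl; rewrite lee_fin; exact: phi_nd.
Qed.

Let Fk_le k y : ((Fk k y)%:E <= F y)%E.
Proof.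
rewrite -(f_meanE (@phi_cont k) (phi_bnd k)); apply: ge0_le_integral => //.
- by move=> w _; rewrite lee_fin; case/andP: (phi_bnd k (X w) y).
- exact: (@measurable_slice_RV (phi k) (@phi_cont k) y).
Qed.

Let F_le_sup y (b : R) : (forall k, Fk k y <= b) -> (F y <= b%:E)%E.
Proof.
move=> Fb; rewrite -(cvg_lim (@ereal_hausdorff R) (@F_cvg y)).
apply: lime_le; first by apply/cvg_ex; eexists; exact: F_cvg.
by apply: nearW => k; rewrite lee_fin.
Qed.

Let F_ge0 y : (0 <= F y)%E.
Proof. exact: integral_ge0. Qed.

(** As the supremum of the continuous [Fk k], [F] is lower semicontinuous: if [F z < F y], some
    [Fk k] already exceeds [F z] at [y], hence near [y], and [Fk k <= F]. *)
Lemma mean_argmin_nonempty : argmin F !=set0.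
Proof.
apply: lsc_compact_argmin => // y z zy.
have /fineK Fz : F z \is a fin_num by rewrite ge0_fin_numE// (lt_le_trans zy) ?leey.
have [k Fk_gt] : exists k, fine (F z) < Fk k y.
  apply: contrapT => /forallNP H.
  have /F_le_sup : forall k, Fk k y <= fine (F z).
    by move=> k; rewrite leNgt; apply/negP; exact: H.
  by rewrite Fz leNgt zy.
pose e := (Fk k y - fine (F z)) / 2.
have e0 : 0 < e by rewrite divr_gt0 ?subr_gt0.
have := f_mean_equicontinuous (@phi_cont k) (phi_bnd k) y e0.
apply: filterS => x [_]; rewrite ler_distl => /andP[+ _].
rewrite -/(Fk k x) -/(Fk k y) => Fkx.
apply: lt_le_trans (Fk_le k x); rewrite -Fz lte_fin.
apply: lt_le_trans Fkx.
by rewrite /e; move: Fk_gt; move: (Fk k y) (fine (F z)) => a b; lra.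
Qed.

(** The loss may be infinite at some points, but a finite mean makes it finite almost surely at all
    samples at once, so the real-valued law applies to its finite part. *)
Let slln_ub_h y : F y \is a fin_num ->
  {ae P, forall w, forall e, 0 < e -> \forall k \near \oo,
    (\sum_(i < k) h (Xs i w) y <= (k%:R * (fine (F y) + e))%:E)%E}.
Proof.
move=> Fy.
have ae_fin (Y : {RV P >-> borel M}) : (\int[P]_w h (Y w) y)%E = F y ->
    {ae P, forall w, h (Y w) y \is a fin_num}.
  move=> EY.
  have : P.-integrable setT (fun w => h (Y w) y).
    apply/integrableP; split; first exact: measurable_h_RV.
    under eq_integral => w _ do rewrite gee0_abs//.
    by rewrite EY -ge0_fin_numE.
  move/(integrable_ae measurableT); apply: filterS => w; exact.
pose u x := fine (h x y).
have mu : measurable_fun [set: borel M] u.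
  by apply: measurableT_comp => //; exact: measurable_limit_slice.
have u0 x : 0 <= u x by exact: fine_ge0.
have uF : (\int[P]_w (u (X w))%:E = (fine (F y))%:E)%E.
  rewrite fineK//; apply: ge0_ae_eq_integral => //.
  - by apply/measurable_EFinP; exact: measurableT_comp mu _.
  - by move=> w _; rewrite lee_fin.
  - by apply: filterS (ae_fin X erefl) => w hw _; rewrite fineK.
have {}ae_fin : {ae P, forall w, forall i, h (Xs i w) y \is a fin_num}.
  apply: ae_foralln => i; apply: ae_fin.
  exact: (integral_iid Xs_iid i (measurable_limit_slice y) (fun x => h_ge0 x y)).
apply: filterS2 ae_fin (slln_ub_iid Xs_iid mu u0 uF) => w hw H e e0.
apply: filterS (H e e0) => k Hk.
rewrite (eq_bigr (fun i : 'I_k => (u (Xs i w))%:E)); last first.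
  by move=> i _; rewrite fineK.
by rewrite sumEFin lee_fin.
Qed.

Lemma ziezold_consistency :
  {ae P, forall w,
    \bigcap_(k in [set k | (0 < k)%N])
      closure (\bigcup_(m in [set m | (k <= m)%N])
        argmin (fun y => \sum_(i < m) h (Xs i w) y)%E)
    `<=` argmin F}.
Proof.
have [y ymin] := mean_argmin_nonempty.
have [Fy|] := boolP (F y \is a fin_num); last first.
  (* If the minimal mean is infinite, [F] is constantly [+oo] and every point minimises it. *)
  rewrite ge0_fin_numE// -leNgt leye_eq => /eqP Fy.
  apply: aeW => w z _ x /=; apply: le_trans (ymin x).
  by rewrite Fy leey.
have lbs : {ae P, forall w, forall k : nat, forall e, 0 < e ->
    \forall m \near \oo, forall z,
      m%:R * (Fk k z - e) <= \sum_(i < m) phi k (Xs i w) z}.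
  apply: ae_foralln => k.
  exact: (uniform_slln_lb (@phi_cont k) (phi_bnd k)).
apply: filterS2 (slln_ub_h Fy) lbs => w ub lb z zE x.
apply: le_trans (ymin x); rewrite -(fineK Fy).
apply: F_le_sup => k; apply/ler_addgt0Pr => e e0.
(* One third for each law of large numbers and one for passing from the empirical minimiser [v] to
   the cluster point [z]. *)
pose r := e / 3; have r0 : 0 < r by rewrite divr_gt0.
have [m0 _ Hm0] : \forall m \near \oo,
    (\sum_(i < m) h (Xs i w) y <= (m%:R * (fine (F y) + r))%:E)%E /\
    forall z, m%:R * (Fk k z - r) <= \sum_(i < m) phi k (Xs i w) z.
  by apply: filterS2 (ub r r0) (lb k r r0).
(* Near the cluster point there is a minimiser [v] for some sample size [m > m0], which is in
   particular positive. *)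
have [v [[m /= m0m vm] [_ zv]]] := zE m0.+1 isT _
  (f_mean_equicontinuous (@phi_cont k) (phi_bnd k) z r0).
have [um lm] := Hm0 m (ltnW m0m).
have mpos : 0 < m%:R :> R by rewrite ltr0n (leq_trans _ m0m).
(* The left side is at most the sum of [phi k] at [v], hence of [h] at [v], hence of [h] at [y]
   because [v] minimises the empirical loss. *)
have : m%:R * (Fk k v - r) <= m%:R * (fine (F y) + r).
  apply: le_trans (lm v) _; rewrite -lee_fin; apply: le_trans um.
  apply: le_trans (vm y); rewrite -sumEFin; exact: lee_sum.
rewrite ler_pM2l// => vy.
move: zv; rewrite ler_distl => /andP[+ _]; rewrite -/(Fk k z) -/(Fk k v).
have : e = r + r + r by rewrite /r; field.
by move=> ->; move: vy; move: (r) (Fk k v) (Fk k z) (fine (F y)) => a b c f; lra.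
Qed.

End Ziezold.

End MEstimators.

(** * Riemannian balls *)

Lemma cvg_bigsum (R : numFieldType) (Z : Type) (F : set_system Z)
  (I : Type) (r : seq I) (f : I -> Z -> R) (l : I -> R) : Filter F ->
  (forall i, f i z @[z --> F] --> l i) ->
  (\sum_(i <- r) f i z) @[z --> F] --> \sum_(i <- r) l i.
Proof.
move=> FF fl; elim: r => [|i r IHr].
  under eq_fun do rewrite big_nil; rewrite big_nil; exact: cvg_cst.
under eq_fun do rewrite big_cons; rewrite big_cons; exact: cvgD.
Qed.

Lemma cvg_quadratic_form (R : realType) (n : nat) (Z : Type)
  (F : set_system Z) (u : Z -> 'rV[R]_n) (G : Z -> 'M[R]_n)
  (u0 : 'rV[R]_n) (G0 : 'M[R]_n) : Filter F ->
  (forall a, u z 0 a @[z --> F] --> u0 0 a) ->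
  (forall a b, G z a b @[z --> F] --> G0 a b) ->
  (u z *m G z *m (u z)^T) 0 0 @[z --> F] --> (u0 *m G0 *m u0^T) 0 0.
Proof.
move=> FF uu0 GG0.
have E (v : 'rV[R]_n) (H : 'M[R]_n) :
    (v *m H *m v^T) 0 0 = \sum_b (\sum_a v 0 a * H a b) * v 0 b.
  by rewrite mxE; apply: eq_bigr => b _; rewrite !mxE.
under eq_fun do rewrite E; rewrite E.
apply: cvg_bigsum => b; apply: cvgM => //; apply: cvg_bigsum => a.
exact: cvgM.
Qed.

Lemma segment_derive (R : realType) (n : nat) (v u : 'rV[R]_n) (s : R) :
  derivable (fun s : R => v + s *: u) s 1 /\
  derive1 (fun s : R => v + s *: u) s = u.
Proof.
set c := fun s : R => v + s *: u.
have dc : (fun h => h^-1 *: ((c \o shift s) (h *: 1) - c s)) @ 0^' --> u.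
  apply: cvg_near_cst; near=> h.
  have h0 : h != 0 by near: h; exact: nbhs_dnbhs_neq.
  rewrite /c /= opprD addrACA subrr add0r -scalerBl addrK.
  by rewrite scalerA [h *: 1]mulr1 mulVf// scale1r.
split; first by apply/cvg_ex; exists u.
rewrite derive1E; exact: cvg_lim dc.
Unshelve. all: by end_near. Qed.

Section RiemannianBalls.
Variables (R : realType) (n : nat) (M : ptopologicalType).
Variable g : riemannian_manifold R n M.

Lemma metric_entry_continuous (i : chart g) (v : 'rV[R]_n) (a b : 'I_n) :
  (chart_coord i @` dom i) v ->
  {for v, continuous (fun w => metric i (chart_param i w) a b)}.
Proof. by move=> Uv; have [] := metric_smooth a b (k := 0) (s := [::]) isT Uv. Qed.

(* Join x to z by a straight segment in a chart around x. *)
Lemma riemannian_dist_near (x : M) (e : R) : 0 < e ->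
  \forall z \near x, (riemannian_dist g x z < e%:E)%E.
Proof.
move=> e0; pose i := chart_at g x; pose v0 := chart_coord i x.
pose U := chart_coord i @` dom i.
have domx : dom i x by exact: dom_chart_at.
have Uv0 : U v0 by exists x.
(* Speed as a function of position and velocity. It is continuous at [(v0, 0)] and vanishes there,
   so slow segments near [v0] are short. *)
pose len (z : 'rV[R]_n * 'rV[R]_n) :=
  Num.sqrt ((z.2 *m metric i (chart_param i z.1) *m z.2^T) 0 0).
pose quad (z : 'rV[R]_n * 'rV[R]_n) :=
  (z.2 *m metric i (chart_param i z.1) *m z.2^T) 0 0.
have quad_cont : quad z @[z --> nbhs (v0, 0 : 'rV[R]_n)] --> quad (v0, 0).
  apply: cvg_quadratic_form => [a|a b].
    apply: (@cvg_comp _ _ _ snd (fun u : 'rV[R]_n => u 0 a) _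
      (nbhs (0 : 'rV[R]_n))); first exact: cvg_snd.
    exact: coord_continuous.
  apply: (@cvg_comp _ _ _ fst
    (fun v => metric i (chart_param i v) a b) _ (nbhs v0)); first exact: cvg_fst.
  exact: metric_entry_continuous.
have len_cont : len z @[z --> nbhs (v0, 0 : 'rV[R]_n)] --> (0 : R).
  have := cvg_comp _ _ quad_cont (@sqrt_continuous R _).
  by rewrite {2}/quad /= !mul0mx mxE sqrtr0.
have e20 : 0 < e / 2 by rewrite divr_gt0.
have /cvgrPdist_lt/(_ _ e20)/nbhs_ballP[r /= r0 rP] := len_cont.
have /nbhs_ballP[r' /= r'0 r'P] : nbhs v0 U.
  by apply: open_nbhs_nbhs; split => //; exact: open_codom.
(* Within [r'] the segment stays in the chart image; within [r] of [(v0, 0)], position and velocity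
   together keep the speed below [e / 2]. *)
pose q := Num.min r r'.
have q0 : 0 < q by rewrite lt_min r0.
have near_dom : \forall z \near x, dom i z.
  by apply: open_nbhs_nbhs; split => //; exact: open_dom.
have near_coord : \forall z \near x, `|v0 - chart_coord i z| < q.
  by have /cvgrPdist_lt/(_ _ q0) := Defs.coord_continuous domx.
apply: filterS2 near_dom near_coord => z domz zq.
pose u := chart_coord i z - v0.
have uq : `|u| < q by rewrite distrC.
pose c (s : R) : 'rV[R]_n := v0 + s *: u.
have cq s : 0 <= s <= 1 -> `|v0 - c s| < q.
  move=> /andP[s0 s1]; rewrite /c opprD addNKr normrN normrZ ger0_norm//.
  by rewrite (le_lt_trans _ uq)// ler_piMl.
have cU s : 0 <= s <= 1 -> U (c s).
  move=> s01; apply: r'P; rewrite -ball_normE /=.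
  by rewrite (lt_le_trans (cq s s01))// ge_min lexx orbT.
have dc s := segment_derive v0 u s.
have lenE s : Num.sqrt ((derive1 c s *m metric i (chart_param i (c s)) *m
    (derive1 c s)^T) 0 0) = len (c s, u) by rewrite /len /= (dc s).2.
have len_lt s : 0 <= s <= 1 -> len (c s, u) < e / 2.
  move=> s01.
  have : ball (v0, 0 : 'rV[R]_n) r (c s, u).
    split; rewrite /= -ball_normE /= ?sub0r ?normrN.
      by rewrite (lt_le_trans (cq s s01))// ge_min lexx.
    by rewrite (lt_le_trans uq)// ge_min lexx.
  by move/rP; rewrite /= sub0r normrN ger0_norm// sqrtr_ge0.
(* Continuity along the segment gives measurability of the integrand of the length. *)
have len_seg (s : R) : 0 <= s <= 1 ->
    {for s, continuous (fun s : R => len (c s, u))}.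
  move=> s01.
  have : quad (c s', u) @[s' --> nbhs s] --> quad (c s, u).
    apply: cvg_quadratic_form => /= [a|a b]; first exact: cvg_cst.
    apply: (@cvg_comp _ _ _ c (fun v => metric i (chart_param i v) a b) _
      (nbhs (c s))); last exact/metric_entry_continuous/cU.
    apply: cvgD; first exact: cvg_cst.
    by apply: cvgZr_tmp.
  move=> quad_seg; exact: cvg_comp _ _ quad_seg (@sqrt_continuous R _).
have c0 : chart_param i (c 0) = x by rewrite /c scale0r addr0 chart_coordK.
have c1 : chart_param i (c 1) = z.
  by rewrite /c scale1r /u addrC subrK chart_coordK.
have : curve_length g x z (chart_length i c + 0)%E.
  rewrite -{1}c0; apply: curve_cons => //.
  - by move=> s; have [] := dc s.
  - rewrite (_ : derive1 c = cst u); first exact: cst_continuous.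
    by apply/funext => s; have [] := dc s.
  - by rewrite c1; exact: curve_nil.
rewrite adde0 => xz; apply: (@le_lt_trans _ _ (chart_length i c)).
  exact: ereal_inf_lbound.
apply: (@le_lt_trans _ _ (e / 2)%:E); last by rewrite lte_fin; lra.
rewrite /chart_length; under eq_integral do rewrite lenE.
have m01 : measurable `[(0 : R)%R, 1%R] by exact: measurable_itv.
have -> : (e / 2)%:E =
    (\int[lebesgue_measure]_(s in `[(0 : R)%R, 1%R]) (e / 2)%:E)%E.
  rewrite integral_cst//= lebesgue_measure_itv /= lte_fin ltr01.
  by rewrite oppr0 adde0 mule1.
apply: ge0_le_integral => //.
- by move=> s _; rewrite lee_fin sqrtr_ge0.
- apply/measurable_EFinP; apply: subspace_continuous_measurable_fun => //.
  apply: continuous_in_subspaceT => s; rewrite inE /= in_itv /= => s01.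
  exact: len_seg.
- by move=> s /=; rewrite in_itv /= => s01; rewrite lee_fin ltW// len_lt.
Qed.

Lemma nbhd_of_set_nbhs (E : set M) (e : R) (x : M) : 0 < e -> E x ->
  nbhs x (nbhd_of_set g E e).
Proof.
move=> e0 Ex; apply: filterS (riemannian_dist_near x e0) => z xz.
by exists x.
Qed.

End RiemannianBalls.

(** * Negative log-densities *)

Lemma compact2_bounded_above (R : realType) (M : ptopologicalType)
  (f : M -> M -> R) : compact [set: M] ->
  continuous (fun z : M * M => f z.1 z.2) ->
  exists B, forall x y, f x y <= B.
Proof.
move=> cM cf.
have cMM : compact [set: M * M] by rewrite -setXTT; exact: compact_setX.
have [] := compact_EVT_max (f := fun z : M * M => f z.1 z.2) _ cMM _.
- by exists (point, point).
- exact: continuous_subspaceT.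
move=> [x0 y0] _ fmax; exists (f x0 y0) => x y.
by have := fmax (x, y); rewrite inE; apply.
Qed.

Section CappedLog.
Variables (R : realType) (C : R).
Hypothesis C0 : 0 < C.

(** This is [min (- ln (q / C)) k] for [q > 0]. With the maximum inside the logarithm its argument
    never drops below [C * expR (- k%:R)], which gives continuity through [q = 0], where the value
    is [k]. *)
Definition capped_log (k : nat) (q : R) : R :=
  ln C - ln (Num.max q (C * expR (- k%:R))).

Let floor_gt0 k : 0 < C * expR (- k%:R).
Proof. by rewrite mulr_gt0// expR_gt0. Qed.

Let max_gt0 k q : 0 < Num.max q (C * expR (- k%:R)).
Proof. by rewrite lt_max floor_gt0 orbT. Qed.

Let ln_floor k : ln (C * expR (- k%:R)) = ln C - k%:R.
Proof. by rewrite lnM ?posrE ?expR_gt0// expRK. Qed.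

Lemma capped_log_bnd k q : q <= C -> 0 <= capped_log k q <= k%:R.
Proof.
move=> qC; rewrite /capped_log subr_ge0 lerBlDl -lerBlDr -ln_floor.
rewrite !ler_ln ?posrE//.
by rewrite le_max lexx orbT andbT ge_max qC/= ler_piMr ?(ltW C0).
Qed.

Lemma capped_log_nd q : {homo capped_log^~ q : k l / (k <= l)%N >-> k <= l}.
Proof.
move=> k l kl; rewrite /capped_log lerD2l lerN2 ler_ln ?posrE//.
rewrite ge_max !le_max lexx/= ler_pM2l// ler_expR lerN2 ler_nat kl.
by rewrite orbT.
Qed.

Lemma capped_log_continuous k : continuous (capped_log k).
Proof.
move=> q; apply: cvgB; first exact: cvg_cst.
have max_cont : {for q, continuous (fun q => Num.max q (C * expR (- k%:R)))}.
  by apply: (@continuous_max R R^o id (cst _)); [exact: cvg_id|exact: cvg_cst].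
exact: cvg_comp _ _ max_cont (continuous_ln (max_gt0 k q)).
Qed.

Lemma capped_log_cvg q : 0 <= q ->
  (capped_log k q)%:E @[k --> \oo] --> (- lne q%:E + (ln C)%:E)%E.
Proof.
(* At [q = 0] the capped value is [k] and tends to [+oo], matching [- lne 0]; for [q > 0] it is
   constant once [k] exceeds [ln C - ln q]. *)
rewrite le_eqVlt => /orP[/eqP <-|q0].
  have -> : (fun k => (capped_log k 0)%:E) = (fun k : nat => (k%:R : R)%:E).
    apply/funext => k; rewrite /capped_log max_r ?ltW// ln_floor.
    by rewrite opprB addrCA subrr addr0.
  rewrite le0_lneNy//= addye//.
  by apply/cvgenyP; exact: cvg_id.
rewrite lne_EFin// -EFinN -EFinD addrC.
apply: cvg_near_cst.
exists (Num.truncn (ln C - ln q)).+1 => // k /= kq.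
rewrite /capped_log max_l// -[leRHS]lnK ?posrE// -[leLHS]lnK ?posrE//.
rewrite ler_expR ln_floor lerBlDr -lerBlDl.
by rewrite (le_trans (ltW (truncnS_gt _)))// ler_nat.
Qed.

End CappedLog.

(** The integral of [f] may be [+oo], so the parts are separated: [f^\+ + c = (f + c) + f^\-] has
    nonnegative terms only, and the integral of [f^\-] is at most [c], so it can be cancelled. *)
Lemma integralD_cst (R : realType) (d : measure_display)
  (T : measurableType d) (P : probability T R) (f : T -> \bar R) (c : R) :
  0 <= c -> measurable_fun setT f -> (forall w, (- c)%:E <= f w)%E ->
  (\int[P]_w (f w + c%:E) = \int[P]_w f w + c%:E)%E.
Proof.
move=> c0 mf fc.
have f_ge w : (0 <= f w + c%:E)%E.
  by have := leeD2r c%:E (fc w); rewrite -EFinD addNr.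
have fneg_le w : (f^\- w <= c%:E)%E.
  by rewrite funenegE ge_max leeNl -EFinN fc lee_fin.
have mfn : measurable_fun setT (f^\-)%E by exact: measurable_funeneg.
have mfp : measurable_fun setT (f^\+)%E by exact: measurable_funepos.
have /fineK neg_fin : (\int[P]_w f^\- w)%E \is a fin_num.
  rewrite ge0_fin_numE; last by apply: integral_ge0.
  apply: (@le_lt_trans _ _ (\int[P]_w c%:E)%E); first exact: ge0_le_integral.
  by rewrite integral_cst_probability ltry.
have : (\int[P]_w f^\+ w + \int[P]_w c%:E =
    \int[P]_w (f w + c%:E) + \int[P]_w f^\- w)%E.
  rewrite -!ge0_integralD//; last exact: emeasurable_funD.
  apply: eq_integral => w _; rewrite funeposE funenegE.
  case: (f w) (fc w) => [r| |] //= _; last by rewrite maxye maxNye adde0.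
  rewrite -!EFin_max -!EFinD; congr EFin.
  have [r0|r0] := leP r 0; first by rewrite max_l ?oppr_ge0//; lra.
  by rewrite max_r ?oppr_le0 ?ltW//; lra.
rewrite integral_cst_probability -neg_fin => E.
rewrite [in RHS]integralE -neg_fin -addeA [X in (_ + X)%E]addeC addeA E.
by rewrite addeK.
Qed.

(** * Consistency of the diffusion estimator *)

Unset Implicit Arguments.
Set Strict Implicit.

Theorem corollary4p4 (R : realType) (n : nat) (M : ptopologicalType)
  (g : riemannian_manifold R n M)
  (M_compact : compact [set: M]) (M_connected : connected [set: M])
  (vol : {measure set (borel M) -> \bar R})
  (vol_g : is_riemannian_volume g vol)
  (p : M -> M -> R -> R) (p_heat : heat_kernel g vol p)
  (d : measure_display) (T : measurableType d) (P : probability T R)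
  (X : {RV P >-> borel M}) (Xs : nat -> {RV P >-> borel M})
  (Xs_iid : iid_samples X Xs)
  (t : R) (t_gt0 : 0 < t) :
  {ae P, forall w,
    \bigcap_(k in [set k | (0 < k)%N])
      closure (\bigcup_(m in [set m | (k <= m)%N])
        diffusion_estimator p Xs t m w)
    `<=` diffusion_mean_set p X t} /\
  diffusion_mean_set p X t !=set0 /\
  forall e : R, 0 < e ->
    {ae P, forall w, exists k : nat, (0 < k)%N /\
      \bigcup_(m in [set m | (k <= m)%N]) diffusion_estimator p Xs t m w
      `<=` nbhd_of_set g (diffusion_mean_set p X t) e}.
Proof.
have p_cont : continuous (fun z : M * M => p z.1 z.2 t).
  move=> [x y].
  apply: (@continuous_comp _ _ _ (fun z : M * M => (z, t))
    (fun z : M * M * R => p z.1.1 z.1.2 z.2)).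
    apply: (cvg_pair (F := nbhs (x, y)) (G := nbhs (x, y)) (H := nbhs t)
      (f := id) (g := cst t)); [exact: cvg_id|exact: cvg_cst].
  exact: (fundamental_continuous (heat_kernel_fundamental p_heat) t_gt0).
have p_ge0 x y : 0 <= p x y t by exact: (heat_kernel_ge0 p_heat).
have [B pB] := compact2_bounded_above (f := fun x y => p x y t) M_compact p_cont.
(* The [1] makes [C] positive and [ln C] nonnegative, as [capped_log] and [integralD_cst]
   require. *)
pose C := Num.max B 1.
have C_gt0 : 0 < C by rewrite lt_max ltr01 orbT.
have pC x y : p x y t <= C by rewrite le_max pB.
have lnC_ge0 : 0 <= ln C by rewrite ln_ge0// le_max lexx orbT.
pose h x y := (neg_log_density p t x y + (ln C)%:E)%E.
pose phi k x y := capped_log C k (p x y t).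
have phi_cont k : continuous (fun z : M * M => phi k z.1 z.2).
  move=> z; exact: cvg_comp _ _ (p_cont z)
    (@capped_log_continuous _ _ C_gt0 k (p z.1 z.2 t)).
have phi_bnd k x y : 0 <= phi k x y <= k%:R by exact: capped_log_bnd.
have phi_nd x y : {homo (fun k => phi k x y) : k l / (k <= l)%N >-> k <= l}.
  exact: capped_log_nd.
have phi_cvg x y : (phi k x y)%:E @[k --> \oo] --> h x y.
  exact: capped_log_cvg.
have h_ge0 x y : (0 <= h x y)%E.
  apply: (cvge_ge _ (phi_cvg x y)); apply: nearW => k.
  by rewrite lee_fin; case/andP: (phi_bnd k x y).
have neg_logE x y : neg_log_density p t x y = (h x y - (ln C)%:E)%E.
  by rewrite /h addeK.
have neg_log_ge x y : ((- ln C)%:E <= neg_log_density p t x y)%E.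
  by rewrite neg_logE EFinN leeDr.
(* Shifting the mean loss by the finite constant [ln C] leaves its minimisers unchanged. *)
have mean_setE : diffusion_mean_set p X t =
    argmin (fun y => \int[P]_w h (X w) y)%E.
  have hE y : (\int[P]_w h (X w) y =
      \int[P]_w neg_log_density p t (X w) y + (ln C)%:E)%E.
    apply: integralD_cst => //.
    under eq_fun do rewrite neg_logE.
    apply: emeasurable_funB => //.
    have mh := measurable_limit_slice phi_cont phi_cvg y.
    exact: measurableT_comp mh _.
  by apply/seteqP; split=> y ymin z; have := ymin z; rewrite !hE leeD2rE.
(* The samples shift the empirical sum by [m * ln C] in total, and the positive factor [1 / m]
   cancels from the comparison. *)
have estimatorE m w : (0 < m)%N -> diffusion_estimator p Xs t m w =
    argmin (fun y => \sum_(i < m) h (Xs i w) y)%E.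
  move=> m0.
  have hE y : (\sum_(i < m) h (Xs i w) y =
      \sum_(i < m) neg_log_density p t (Xs i w) y + (m%:R * ln C)%:E)%E.
    rewrite big_split/= sumEFin sumr_const card_ord mulr_natl.
    by [].
  have m_gt0 : (0 < (m%:R^-1 : R)%:E)%E by rewrite lte_fin invr_gt0 ltr0n.
  apply/seteqP; split=> y ymin z; have := ymin z; rewrite /argmin /=.
    by rewrite !hE leeD2rE// lee_pmul2l.
  by rewrite !hE leeD2rE// lee_pmul2l.
have ziezold : {ae P, forall w,
    \bigcap_(k in [set k | (0 < k)%N])
      closure (\bigcup_(m in [set m | (k <= m)%N])
        diffusion_estimator p Xs t m w)
    `<=` diffusion_mean_set p X t}.
  have := ziezold_consistency M_compact Xs_iid phi_cont phi_bnd phi_nd phi_cvg.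
  apply: filterS => w; rewrite mean_setE => H z zE; apply: H => k k0.
  apply: closure_subset (zE k k0) => x [m /= km xm]; exists m => //.
  by rewrite -estimatorE// (leq_trans k0).
split; first exact: ziezold.
split.
  by rewrite mean_setE; exact: mean_argmin_nonempty phi_cont phi_bnd phi_nd phi_cvg.
(* Every outcome satisfying the first inclusion satisfies the second for this [e], by compactness
   alone. *)
move=> e e0; apply: filterS ziezold => w zw.
apply: eventually_subset_of_closure zw _ => // x.
exact: nbhd_of_set_nbhs.
Qed.
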